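(* Let $m\in\mathbb{N}$ and $q=(q_1,\dots,q_d)\in\mathbb{Z}_+^d$. Let $\mathbf{T}=(T_1,\dots,T_d)\in\mathcal{B}(\mathcal{H})^d$ be a joint $(m;(q_1,\dots,q_d))$-partial isometry such that $\mathcal{N}(\mathbf{T}^q)$ is a reducing subspace for each $T_j$, $1\le j\le d$. Then $$\sigma_{ap}(\mathbf{T})\subset\partial\mathbb{B}(\mathbb{C}^d)\cup[0],\qquad\text{where } [0]:=\Big\{(\lambda_1,\dots,\lambda_d)\in\mathbb{C}^d:\ \prod_{1\le k\le d}\lambda_k=0\Big\}.$$
   Context: $\mathcal{H}$ is an infinite-dimensional separable complex Hilbert space, $\mathcal{B}(\mathcal{H})$ the algebra of bounded linear operators on $\mathcal{H}$, $\mathbb{N}$ the positive integers, $\mathbb{Z}_+$ the nonnegative integers, $d\in\mathbb{N}$. $\mathcal{N}(A)$ denotes the null space of $A$. A tuple $\mathbf{T}=(T_1,\dots,T_d)$ is commuting if $T_iT_j=T_jT_i$ for all $i,j$. For $\alpha\in\mathbb{Z}_+^d$: $|\alpha|=\sum_j\alpha_j$, $\alpha!=\alpha_1!\cdots\alpha_d!$, $\mathbf{T}^\alpha=T_1^{\alpha_1}\cdots T_d^{\alpha_d}$, and $\mathbf{T}^{*\alpha}=(T_1^* )^{\alpha_1}\cdots(T_d^* )^{\alpha_d}$. Given $m\in\mathbb{N}$ and $q\in\mathbb{Z}_+^d$, a commuting tuple $\mathbf{T}\in\mathcal{B}(\mathcal{H})^d$ is a joint $(m;(q_1,\dots,q_d))$-partial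 isometry if $\mathbf{T}^q\Big(\sum_{0\le k\le m}(-1)^k\binom{m}{k}\sum_{|\alpha|=k}\frac{k!}{\alpha!}\mathbf{T}^{*\alpha}\mathbf{T}^\alpha\Big)=0$. The joint approximate point spectrum $\sigma_{ap}(\mathbf{T})$ is the set of $\lambda=(\lambda_1,\dots,\lambda_d)\in\mathbb{C}^d$ for which there is a sequence $(x_n)_n$ of unit vectors in $\mathcal{H}$ with $(T_j-\lambda_j)x_n\to0$ as $n\to\infty$ for every $j=1,\dots,d$. Also $\|\lambda\|_2=(\sum_j|\lambda_j|^2)^{1/2}$ and $\partial\mathbb{B}(\mathbb{C}^d)=\{\lambda\in\mathbb{C}^d:\|\lambda\|_2=1\}$. *)

(* Defs.v *)
From HB Require Import structures.
From mathcomp Require Import all_boot all_order all_algebra.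
From mathcomp Require Import complex ring.
From mathcomp Require Import all_classical all_reals all_analysis.

Set Implicit Arguments.
Unset Strict Implicit.
Unset Printing Implicit Defensive.

Import Order.TTheory GRing.Theory Num.Theory.
Import numFieldNormedType.Exports.

Local Open Scope classical_set_scope.
Local Open Scope ring_scope.

(* The inner product is linear in its first argument and conjugate-linear in
   the second one. *)
HB.mixin Record NormedModule_isHilbert (R : realType) H
    of CompleteNormedModule R[i] H := {
  inner : {dot H for (@Num.conj R[i])};
  innerE : forall x : H, inner x x = `|x| ^+ 2 }.

#[short(type="hilbertType")]
HB.structure Definition Hilbert (R : realType) :=
  {H of CompleteNormedModule R[i] H & NormedModule_isHilbert R H}.

Notation "''[' u , v ]" := (inner u%R v%R) : ring_scope.

Section HilbertSpace.
Variables (R : realType) (H : hilbertType R).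

Definition separable := exists2 D : set H, countable D & dense D.

Definition finite_dimensional := exists (n : nat) (e : 'I_n -> H),
  forall x, exists c : 'I_n -> R[i], x = \sum_i c i *: e i.

Definition bounded_operator (A : {linear H -> H}) :=
  bounded_near A (nbhs (0 : H)).

Lemma innerC (x y : H) : '[x, y] = ('[y, x])^*.
Proof. by rewrite hermC expr0 mul1r. Qed.

Lemma innerDl (x y z : H) : '[x + y, z] = '[x, z] + '[y, z].
Proof. exact: linearDl. Qed.

Lemma innerDr (x y z : H) : '[x, y + z] = '[x, y] + '[x, z].
Proof. exact: linearD. Qed.

Lemma innerZl (a : R[i]) (x y : H) : '[a *: x, y] = a * '[x, y].
Proof. exact: linearZl_LR. Qed.

Lemma innerZr (a : R[i]) (x y : H) : '[x, a *: y] = a^* * '[x, y].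
Proof. by rewrite linearZ. Qed.

Lemma inner_inj (y z : H) : (forall x, '[x, y] = '[x, z]) -> y = z.
Proof.
move=> yz; apply/eqP; rewrite -subr_eq0 -normr_eq0 -sqrf_eq0 -innerE.
by rewrite linearB /= yz subrr.
Qed.

Lemma cauchy_schwarz (x y : H) : `|'[x, y]| <= `|x| * `|y|.
Proof.
have [->|y0] := eqVneq y 0; first by rewrite linear0 !normr0 mulr0.
have ny0 : `|y| != 0 by rewrite normr_eq0.
rewrite -(@ler_pXn2r _ 2) // ?nnegrE ?mulr_ge0 // exprMn.
pose a := '[x, y] / `|y| ^+ 2.
have : 0 <= `|x - a *: y| ^+ 2 by rewrite exprn_ge0.
rewrite -!innerE -scaleN1r !(innerDl, innerDr, innerZl, innerZr) !innerE.
rewrite (innerC y x) (normCK '[x, y]) /a rmorphM fmorphV rmorphXn rmorphN rmorph1 /=.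
rewrite (CrealP (normr_real y)).
set n := `|y|; set m := `|x|; set u := '[x, y]; set v := u^*.
rewrite (_ : _ + _ = (m ^+ 2 * n ^+ 2 - u * v) / n ^+ 2); last by field.
by rewrite pmulr_lge0 ?invr_gt0 ?exprn_gt0 ?normr_gt0 // subr_ge0.
Qed.

Lemma real_inf_exists (U : Type) (u0 : U) (f : U -> R[i]) (m : R[i]) :
  (forall x, f x \is Num.real) -> m \is Num.real -> (forall x, m <= f x) ->
  exists l, (forall x, l <= f x) /\ forall e, 0 < e -> exists x, f x < l + e.
Proof.
move=> fR mR mf.
have RReK (z : R[i]) : z \is Num.real -> z = ((complex.Re z)%:C)%C.
  by move=> zR; rewrite RRe_real.
pose A := range (fun x => complex.Re (f x)).
have Ai : has_inf A.
  split; first by exists (complex.Re (f u0)); exists u0.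
  exists (complex.Re m) => _ [x _ <-].
  by rewrite -lecR -!RReK.
exists ((inf A)%:C)%C; split=> [x|e e0].
  rewrite (RReK _ (fR x)) lecR; apply: ge_inf; last by exists x.
  by case: Ai.
have eR : e \is Num.real by apply: gtr0_real.
have e0' : 0 < complex.Re e by rewrite -ltcR -RReK.
have [_ [x _ <-] xe] := inf_adherent e0' Ai.
exists x; rewrite (RReK _ eR) (RReK _ (fR x)) -rmorphD ltcR //.
Qed.

Section Riesz.
Variable f : {linear H -> R[i]^o}.
Variable M : R[i].
Hypothesis M0 : 0 <= M.
Hypothesis fM : forall x, `|f x| <= M * `|x|.

(* The representing vector minimizes the quadratic functional P, whose
   minimizing sequences are Cauchy by the parallelogram identity Ppar. *)
Let P (z : H) : R[i] := '[z, z] - f z - (f z)^*.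

Let fD x y : f (x + y) = (f x : R[i]) + f y.
Proof. exact: linearD. Qed.

Let fZ a x : f (a *: x) = (a : R[i]) * f x.
Proof. exact: linearZ. Qed.

Let PR z : P z \is Num.real.
Proof.
rewrite /P innerE -addrA -opprD rpredB ?rpredX ?normr_real //.
by rewrite CrealE rmorphD /= conjCK addrC.
Qed.

Let fre z : f z + (f z)^* <= 2 * (M * `|z|).
Proof.
have : `|f z + (f z)^*| <= 2 * (M * `|z|).
  by rewrite (le_trans (ler_normD _ _)) // norm_conjC mulr_natl mulr2n lerD.
by apply: le_trans; apply: real_ler_norm; rewrite CrealE rmorphD /= conjCK addrC.
Qed.

Let Pge z : - M ^+ 2 <= P z.
Proof.
rewrite /P innerE -addrA -opprD.
have h := fre z.
apply: (@le_trans _ _ (`|z| ^+ 2 - 2 * (M * `|z|))); last by rewrite lerD2l lerN2.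
rewrite -subr_ge0 (_ : _ - _ = (`|z| - M) ^+ 2); last by ring.
by rewrite real_exprn_even_ge0 // rpredB ?normr_real // ger0_real.
Qed.

Let Ppar z w : `|z - w| ^+ 2 = 2 * P z + 2 * P w - 4 * P (2^-1 *: (z + w)).
Proof.
rewrite -innerE /P -scaleN1r.
rewrite !(innerDl, innerDr, innerZl, innerZr, fD, fZ) !(rmorphD, rmorphM) /=.
rewrite fmorphV rmorphN rmorph1 rmorph_nat (innerC w z).
by field.
Qed.

Let Pvar z s x : P (z + s *: x) = P z + s * ('[x, z] - f x)
   + (s * ('[x, z] - f x))^* + `|s| ^+ 2 * `|x| ^+ 2.
Proof.
rewrite -innerE normCK /P.
rewrite !(innerDl, innerDr, innerZl, innerZr, fD, fZ) !(rmorphD, rmorphM, rmorphN) /=.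
rewrite (innerC z x) ?rmorphN.
by ring.
Qed.

Let Pstep z : (forall w, P z <= P w) -> forall x, f x = '[x, z].
Proof.
move=> zmin x; apply/eqP; rewrite eq_sym -subr_eq0; apply: contraT.
set u := '[x, z] - f x => u0.
pose t : R[i] := (1 + `|x| ^+ 2)^-1.
have x2 : 0 <= `|x| ^+ 2 by rewrite exprn_ge0.
have d0 : 0 < 1 + `|x| ^+ 2 by rewrite ltr_wpDr.
have t0 : 0 < t by rewrite invr_gt0.
have tR : t^* = t by apply/CrealP; exact: gtr0_real.
have := zmin (z + (- t * u^*) *: x).
rewrite Pvar -/u normrM normrN norm_conjC (gtr0_norm t0).
rewrite -mulrA [u^* * u]mulrC -normCK rmorphM rmorphN rmorphXn /= tR.
rewrite (CrealP (normr_real u)) -subr_ge0.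
rewrite (_ : _ - _ = - (`|u| ^+ 2 * t * (1 + t))).
  rewrite oppr_ge0 => h; suff : 0 < `|u| ^+ 2 * t * (1 + t).
    by move=> h'; move: (lt_le_trans h' h); rewrite ltxx.
  by rewrite !mulr_gt0 ?exprn_gt0 ?normr_gt0 // ltr_wpDr // ltW.
have -> : `|x| ^+ 2 = t^-1 - 1 by rewrite invrK addrAC subrr add0r.
have tn0 : t != 0 by rewrite gt_eqF.
by field.
Qed.

Lemma riesz_representation : exists z, forall x, f x = '[x, z].
Proof.
have M2R : - M ^+ 2 \is Num.real by rewrite rpredN rpredX // ger0_real.
have [l [lP lx]] := real_inf_exists (0 : H) PR M2R Pge.
pose F : set_system H := filter_from [set e : R[i] | 0 < e]
  (fun e => [set z | P z < l + e]).
have FF : ProperFilter F.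
  apply: filter_from_proper.
    apply: filter_from_filter; first by exists 1 => /=.
    move=> e1 e2 /= e10 e20.
    have [e12|e21] := real_leP (gtr0_real e10) (gtr0_real e20).
      by exists e1 => // x /= xl; split=> //; rewrite (lt_le_trans xl) // lerD2l.
    by exists e2 => // x /= xl; split=> //; rewrite (lt_trans xl) // ltrD2l.
  by move=> e /= /lx.
have Fclose e z w : P z < l + e -> P w < l + e -> `|z - w| ^+ 2 < 4 * e.
  move=> ze we; rewrite Ppar.
  have h := lP (2^-1 *: (z + w)).
  rewrite -subr_gt0.
  have -> : 4 * e - (2 * P z + 2 * P w - 4 * P (2^-1 *: (z + w))) =
    2 * (l + e - P z) + 2 * (l + e - P w) + 4 * (P (2^-1 *: (z + w)) - l) by ring.
  by rewrite ltr_wpDr ?mulr_ge0 ?subr_ge0 // addr_gt0 // mulr_gt0 ?subr_gt0.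
have /cauchy_cvg /cvg_ex [z Fz] : cauchy F.
  apply/cauchy_ballP => e e0.
  exists ([set z | P z < l + e ^+ 2 / 4], [set z | P z < l + e ^+ 2 / 4]).
    by split; exists (e ^+ 2 / 4) => //=; rewrite divr_gt0 ?exprn_gt0.
  move=> [a b] [/= /Fclose /[apply]]; rewrite mulrC divfK // => h.
  rewrite -ball_normE /ball_ /= -(@ltr_pXn2r _ 2) // nnegrE // ltW //.
exists z; apply: Pstep => w; apply: le_trans (lP w).
apply/ler_addgt0Pr => e e0.
pose e3 := e / 3; have e30 : 0 < e3 by rewrite divr_gt0.
have nF : `|w| @[w --> F] --> `|z| by exact: cvg_norm.
have n2F : (`|w| * `|w| : R[i]^o) @[w --> F] --> (`|z| * `|z| : R[i]^o).
  exact: (@cvgM R[i] _ _ _ (fun w => `|w|) (fun w => `|w|)).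
have M1 : 0 < 2 * (M + 1) by rewrite mulr_gt0 // ltr_wpDl.
have d0 : 0 < e3 / (2 * (M + 1)) by rewrite divr_gt0.
have Fz' : w @[w --> F] --> z by move=> B /Fz.
near F => v.
have Pv : P v < l + e3 by near: v; exists e3.
have v1 : `|z| * `|z| - `|v| * `|v| <= e3.
  apply: le_trans (real_ler_norm _) _.
    by rewrite rpredB // rpredM // normr_real.
  near: v; move: n2F => /cvgrPdist_le /(_ _ e30); exact.
have v2 : `|z - v| <= e3 / (2 * (M + 1)).
  by near: v; move: Fz' => /cvgrPdist_le /(_ _ d0); exact.
have -> : P z = P v + (`|z| * `|z| - `|v| * `|v|) + (f (v - z) + (f (v - z))^*).
  have -> : f (v - z) = (f v : R[i]) - f z by rewrite -scaleN1r fD fZ mulN1r.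
  by rewrite /P !innerE rmorphB /=; ring.
have h : f (v - z) + (f (v - z))^* <= e3.
  apply: le_trans (fre _) _; rewrite distrC.
  apply: (@le_trans _ _ (2 * (M + 1) * `|z - v|)).
    by rewrite mulrA ler_wpM2r // ler_pM2l // lerDl.
  by rewrite mulrC -ler_pdivlMr.
have -> : l + e = (l + e3) + e3 + e3 by rewrite /e3; field.
by apply: lerD h; apply: lerD v1; exact: ltW.
Unshelve. all: by end_near. Qed.

End Riesz.

(* `get` picks an element of a set, if there is one; for bounded A there is
   exactly one such z, by adjointP and inner_inj. *)
Definition adjoint (A : H -> H) (y : H) : H :=
  get [set z | forall x, '[A x, y] = '[x, z]].

Lemma adjointP (A : {linear H -> H}) : bounded_operator A ->
  forall x y, '[A x, y] = '[x, adjoint A y].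
Proof.
move=> /linear_boundedP /pinfty_ex_gt0 [M M0 AM] x y; move: x.
suff : [set z | forall x, '[A x, y] = '[x, z]] (adjoint A y) by [].
apply: getPex.
pose f : H -> R[i]^o := fun x => '[A x, y].
have lf : linear f by move=> a u v; rewrite /f linearP innerDl innerZl.
pose F : {linear H -> R[i]^o} := HB.pack f (GRing.isLinear.Build _ _ _ _ _ lf).
apply: (@riesz_representation F (M * `|y|)).
  by rewrite mulr_ge0 // ltW.
move=> x; rewrite /= /f (le_trans (cauchy_schwarz _ _)) //.
by rewrite mulrAC ler_wpM2r.
Qed.

Definition orthogonal_complement (M : set H) : set H :=
  [set y | forall x, M x -> '[x, y] = 0].

Definition closed_subspace (M : set H) :=
  [/\ closed M, M 0 &
      forall (a : R[i]) (x y : H), M x -> M y -> M (a *: x + y)].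

Definition reducing_subspace (A : H -> H) (M : set H) :=
  [/\ closed_subspace M, A @` M `<=` M &
      A @` orthogonal_complement M `<=` orthogonal_complement M].

Definition null_space (A : H -> H) : set H := [set x | A x = 0].

Section Tuples.
Variables (d : nat).
Implicit Types (T : 'I_d -> H -> H) (q : 'I_d -> nat).

Definition commuting T := forall i j, T i \o T j = T j \o T i.

Definition tuple_power T q : H -> H :=
  \big[(@comp H H H)/idfun]_(j < d) iter (q j) (T j).

(* A multi-index of length k has all its entries at most k, hence the range
   {ffun 'I_d -> 'I_k.+1} of the inner sum. *)
Definition isometry_defect (m : nat) T (x : H) : H :=
  \sum_(k < m.+1) ((-1) ^+ k *+ 'C(m, k)) *:
    \sum_(a : {ffun 'I_d -> 'I_k.+1} | (\sum_j a j)%N == k)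
      (k`!%:R / (\prod_j (a j)`!)%N%:R) *:
        tuple_power (fun j => adjoint (T j)) (fun j => a j)
          (tuple_power T (fun j => a j) x).

Definition joint_partial_isometry (m : nat) q T :=
  commuting T /\ forall x, tuple_power T q (isometry_defect m T x) = 0.

Definition approximate_point_spectrum T : set 'rV[R[i]]_d :=
  [set l : 'rV[R[i]]_d | exists x : nat -> H, (forall n, `|x n| = 1) /\
     forall j, T j (x n) - l 0 j *: x n @[n --> \oo] --> (0 : H)].

End Tuples.
End HilbertSpace.

Section ComplexSpace.
Variables (R : realType) (d : nat).

Definition norm2 (l : 'rV[R[i]]_d) : R[i] := sqrtC (\sum_j `|l 0 j| ^+ 2).

Definition unit_sphere : set 'rV[R[i]]_d := [set l | norm2 l = 1].

Definition zero_product : set 'rV[R[i]]_d :=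
  [set l : 'rV[R[i]]_d | \prod_j l 0 j = 0].

End ComplexSpace.

(* Main.v *)
Require Import Defs.
From mathcomp Require Import all_boot all_order all_algebra.
From mathcomp Require Import complex ring.
From mathcomp Require Import all_classical all_reals all_analysis.

Set Implicit Arguments.
Unset Strict Implicit.
Unset Printing Implicit Defensive.

Import Order.TTheory GRing.Theory Num.Theory.
Import numFieldNormedType.Exports.

Local Open Scope classical_set_scope.
Local Open Scope ring_scope.

(** Fix an approximate joint eigenvalue [l] with unit approximate eigenvectors
    [x n], write [D] for the isometry defect, [s] for the squared euclidean
    norm of [l], and [N] for the null space of [T^q].  The proof evaluates
    the limit of ['[D (x n), T^q (x n)]] in two ways.

    On the one hand each of these numbers is zero.  The equation [T^q D = 0]
    puts the range of [D] inside [N].  Since [N] is closed, every vector [x]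
    is [y + z] with [y] in [N] and [z] orthogonal to [N]
    ([orthogonal_decomposition]); as [N] reduces every [T j], the vector
    [T^q x = T^q z] is again orthogonal to [N] ([tuple_power_orthogonal]).

    On the other hand, moving the adjoints in [D] to the right-hand side turns
    ['[D x, T^q x]] into a combination of the numbers
    ['[T^a x, T^a (T^q x)]] ([inner_isometry_defect]).  Monomials in the [T j]
    act on [x n] asymptotically as the corresponding monomials in [l]
    ([approximate_eigenvalue_tuple_power]), so the multinomial theorem and then
    the binomial theorem identify the limit with
    [(1 - s) ^+ m * (l ^ q)^*] ([cvg_inner_isometry_defect]).

    Hence this product vanishes: either [s = 1], or some coordinate of [l] is
    zero.  The pairing is with [T^q (x n)] rather than with [x n] because the
    former is exactly orthogonal to [N], whereas [x n] is so only in the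
    limit. *)

(** * The multinomial theorem *)

Section Multinomial.
Variable F : numFieldType.

(** The exponential series of [t 'X], truncated after degree [K].  The product
    of such series over [j] is the generating function of the divided
    monomials, which is how the multi-indices of a given length get summed. *)
Definition trunc_exp (K : nat) (t : F) : {poly F} :=
  \poly_(i < K.+1) (t ^+ i / i`!%:R).

Let factF_neq0 n : n`!%:R != 0 :> F.
Proof. by rewrite pnatr_eq0 -lt0n fact_gt0. Qed.

(** Up to degree [K], truncation does not interfere with the identity
    [exp u * exp v = exp (u + v)], which on coefficients is the binomial
    theorem. *)
Lemma coef_prod_trunc_exp (I : Type) (s : seq I) (t : I -> F) (K k : nat) :
  (k <= K)%N ->
  (\prod_(j <- s) trunc_exp K (t j))`_k = (\sum_(j <- s) t j) ^+ k / k`!%:R.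
Proof.
elim: s k => [|j s IHs] k kK.
  by rewrite !big_nil coef1 expr0n; case: k {kK} => [|k]; rewrite ?mul0r ?divr1.
rewrite !big_cons coefM addrC exprDn mulr_suml; apply: eq_bigr => i _.
have ik : (i <= k)%N by rewrite -ltnS.
rewrite coef_poly ltnS (leq_trans ik kK) IHs ?(leq_trans (leq_subr _ _)) //.
rewrite -(bin_fact ik) !natrM -[in RHS]mulr_natr.
have : 'C(k, i)%:R != 0 :> F by rewrite pnatr_eq0 -lt0n bin_gt0.
by move=> C0; field; rewrite C0 !factF_neq0.
Qed.

(** Expanding the product of the [trunc_exp k (t j)] by distributivity makes
    the choice of one term per factor a function ['I_d -> 'I_k.+1], that is, a
    multi-index with entries at most [k]. *)
Lemma multinomial_sum (d k : nat) (t : 'I_d -> F) :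
  \sum_(a : {ffun 'I_d -> 'I_k.+1} | (\sum_j a j)%N == k)
     (k`!%:R / (\prod_j (a j)`!)%N%:R) * \prod_j t j ^+ a j =
  (\sum_j t j) ^+ k.
Proof.
have := coef_prod_trunc_exp (index_enum 'I_d) t (leqnn k).
under eq_bigr do rewrite /trunc_exp poly_def.
rewrite (bigA_distr_bigA
  (fun j (i : 'I_k.+1) => (t j ^+ i / i`!%:R) *: 'X^i : {poly F})).
rewrite coef_sum => coefk; rewrite -[RHS](divfK (factF_neq0 k)) -coefk.
rewrite mulr_suml big_mkcond; apply: eq_bigr => a _.
rewrite scaler_prod prodrXr coefZ coefXn eq_sym.
case: eqP => _; last by rewrite mulr0 mul0r.
by rewrite mulr1 big_split prodfV /= natr_prod mulrC mulrA mulrAC.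
Qed.

End Multinomial.

(** * Orthogonal decomposition along a closed subspace *)

Section OrthogonalProjection.
Variables (R : realType) (H : hilbertType R).

(** This form of the parallelogram law bounds the distance of two near-closest
    points [u], [v] to [x] in a convex set, which contains their midpoint. *)
Lemma parallelogram (x u v : H) :
  `|u - v| ^+ 2 = 2 * `|x - u| ^+ 2 + 2 * `|x - v| ^+ 2
                  - 4 * `|x - 2^-1 *: (u + v)| ^+ 2.
Proof.
rewrite -!innerE -[- v]scaleN1r -[- u]scaleN1r -[- (2^-1 *: _)]scaleN1r.
rewrite !(innerDl, innerDr, innerZl, innerZr) /=.
by rewrite fmorphV rmorphN rmorph1 rmorph_nat; field.
Qed.

(** If moving along the line through [w] in direction [u] can lower the squared
    norm of [w] by at most [e], then [w] is nearly orthogonal to [u]: the best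
    move, removing the component of [w] along [u], gains exactly
    [`|'[w, u]| ^+ 2 / `|u| ^+ 2]. *)
Lemma near_minimizer_almost_orthogonal (w u : H) (l e : R[i]) :
  (forall s : R[i], l <= `|w - s *: u| ^+ 2) -> `|w| ^+ 2 < l + e ->
  `|'[w, u]| ^+ 2 <= e * `|u| ^+ 2.
Proof.
move=> lmin we.
have [->|u0] := eqVneq u 0; first by rewrite linear0 !normr0 expr0n mulr0.
have nu0 : `|u| != 0 by rewrite normr_eq0.
have nu2 : 0 < `|u| ^+ 2 by rewrite exprn_gt0 ?normr_gt0.
have := lmin ('[w, u] / `|u| ^+ 2).
have -> : `|w - ('[w, u] / `|u| ^+ 2) *: u| ^+ 2 =
   `|w| ^+ 2 - `|'[w, u]| ^+ 2 / `|u| ^+ 2.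
  rewrite -!innerE -scaleN1r !(innerDl, innerDr, innerZl, innerZr) !innerE.
  rewrite (innerC u w) normCK rmorphM fmorphV rmorphXn rmorphN rmorph1 /=.
  by rewrite (CrealP (normr_real u)); field.
rewrite lerBrDr -[_ <= e * _]ler_pdivrMr // => lw.
by rewrite -(lerD2l l) ltW // (le_lt_trans lw).
Qed.

(** The projection of [x] is the limit of the filter [G] of points of [M] whose
    squared distance to [x] is nearly the infimum [l].  Orthogonality passes to
    the limit from the near-minimizers, where
    [near_minimizer_almost_orthogonal] provides it approximately. *)
Theorem orthogonal_decomposition (M : set H) : closed_subspace M ->
  forall x, exists2 y, M y & orthogonal_complement M (x - y).
Proof.
move=> [Mc M0 ML] x.
have MD u v : M u -> M v -> M (u + v).
  by move=> Mu Mv; rewrite -[u]scale1r; exact: ML.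
have MZ a u : M u -> M (a *: u).
  by move=> Mu; rewrite -[_ *: _]addr0; exact: ML.
pose f (m : {u | M u}) : R[i] := `|x - sval m| ^+ 2.
have fR m : f m \is Num.real by rewrite rpredX ?normr_real.
have [l [lmin linf]] := real_inf_exists (exist M 0 M0) fR (real0 _)
  (fun m => exprn_ge0 2 (normr_ge0 (x - sval m))).
have lM u : M u -> l <= `|x - u| ^+ 2.
  by move=> Mu; exact: (lmin (exist M u Mu)).
pose G : set_system H := filter_from [set e : R[i] | 0 < e]
  (fun e => [set u | M u /\ `|x - u| ^+ 2 < l + e]).
have GF : ProperFilter G.
  apply: filter_from_proper.
    apply: filter_from_filter; first by exists 1 => /=.
    move=> e1 e2 /= e10 e20.
    have [e12|e21] := real_leP (gtr0_real e10) (gtr0_real e20).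
      exists e1 => // u /= [Mu ul]; split=> //.
      by split=> //; rewrite (lt_le_trans ul) // lerD2l.
    exists e2 => // u /= [Mu ul]; split=> //.
    by split=> //; rewrite (lt_trans ul) // ltrD2l.
  by move=> e /= /linf [[u Mu] ul]; exists u.
have : cauchy G.
  apply/cauchy_ballP => e e0.
  pose B := [set u | M u /\ `|x - u| ^+ 2 < l + e ^+ 2 / 4].
  exists (B, B); first by split; exists (e ^+ 2 / 4) => //=;
    rewrite divr_gt0 ?exprn_gt0.
  move=> [u v] [/= [Mu ul] [Mv vl]].
  rewrite -ball_normE /ball_ /= -(@ltr_pXn2r _ 2) // ?nnegrE ?(ltW e0) //.
  rewrite (parallelogram x) -subr_gt0.
  have h := lM _ (MZ 2^-1 _ (MD _ _ Mu Mv)).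
  rewrite (_ : _ - _ = 2 * (l + e ^+ 2 / 4 - `|x - u| ^+ 2)
     + 2 * (l + e ^+ 2 / 4 - `|x - v| ^+ 2)
     + 4 * (`|x - 2^-1 *: (u + v)| ^+ 2 - l)); last by field.
  by rewrite ltr_wpDr ?mulr_ge0 ?subr_ge0 // addr_gt0 // mulr_gt0 ?subr_gt0.
move=> /cauchy_cvg /cvg_ex [y Gy].
have Gy' : u @[u --> G] --> y by move=> B /Gy.
exists y.
  (* The points of G lie in M, which is closed. *)
  apply: (closed_cvg (u_ := id) (F := G) M Mc) => //.
  by exists 1 => //= u [].
move=> w Mw; apply/eqP; rewrite innerC conjC_eq0 -normr_le0.
apply/ler_addgt0Pr => e e0; rewrite add0r.
pose r := e / 2 / (1 + `|w|).
have w1 : 0 < 1 + `|w| by rewrite ltr_wpDr.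
have r0 : 0 < r by rewrite !divr_gt0.
near G => u.
have [Mu ul] : M u /\ `|x - u| ^+ 2 < l + r ^+ 2.
  by near: u; exists (r ^+ 2) => //=; rewrite exprn_gt0.
have uy : `|u - y| <= r.
  rewrite distrC; near: u; move: Gy' => /cvgrPdist_le /(_ _ r0); exact.
have xu : `|'[x - u, w]| <= r * `|w|.
  have rw0 : 0 <= r * `|w| by rewrite mulr_ge0 // ltW.
  rewrite -(@ler_pXn2r _ 2) // exprMn.
  apply: near_minimizer_almost_orthogonal ul => s.
  by rewrite -addrA -opprD; apply: lM; apply: MD => //; exact: MZ.
have -> : x - y = (x - u) + (u - y) by rewrite addrA subrK.
rewrite innerDl (le_trans (ler_normD _ _)) //.
apply: (@le_trans _ _ (r * `|w| + r * `|w|)).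
  by rewrite lerD // (le_trans (cauchy_schwarz _ _)) // ler_wpM2r.
have -> : e = r * (1 + `|w|) + r * (1 + `|w|).
  by rewrite /r !divfK ?gt_eqF // -splitr.
by rewrite lerD // ler_wpM2l ?(ltW r0) // lerDr.
Unshelve. all: by end_near. Qed.

End OrthogonalProjection.

(** * Monomials in a commuting tuple *)

Section TuplePowers.
Variables (R : realType) (H : hilbertType R) (d : nat).
Implicit Types (T : 'I_d -> {linear H -> H}) (a : 'I_d -> nat).

Lemma adjoint_left (A : {linear H -> H}) : bounded_operator A ->
  forall x y, '[adjoint A x, y] = '[x, A y].
Proof. by move=> bA x y; rewrite innerC -adjointP // -innerC. Qed.

(** Passing to adjoints reverses the order of a composition; commutation
    restores it. *)
Lemma adjoint_tuple_power T a : (forall j, bounded_operator (T j)) ->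
    commuting (fun j => T j) ->
  forall x y, '[tuple_power (fun j => adjoint (T j)) a x, y] =
              '[x, tuple_power (fun j => T j) a y].
Proof.
move=> bT cT x y; rewrite /tuple_power.
have iter_comm i (f : H -> H) n : f \o T i = T i \o f ->
    forall v, f (iter n (T i) v) = iter n (T i) (f v).
  move=> fT v; elim: n => //= n IHn; rewrite -IHn.
  exact: (congr1 (fun g => g (iter n (T i) v)) fT).
have big_comm i (s : seq 'I_d) :
    (\big[@comp H H H/idfun]_(j <- s) iter (a j) (T j)) \o T i =
    T i \o \big[@comp H H H/idfun]_(j <- s) iter (a j) (T j).
  apply/funext => v /=; elim: s => [|j s IHs]; first by rewrite !big_nil.
  rewrite !big_cons /= IHs.
  by rewrite [in RHS](iter_comm j (T i)).
elim: (index_enum 'I_d) y => [|j s IHs] y; first by rewrite !big_nil.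
rewrite !big_cons /= -iter_comm // -IHs.
move: (\big[_/_]_(k <- s) _) => g; elim: (a j) y => //= n IHn y.
by rewrite adjoint_left // IHn -iterSr.
Qed.

Lemma tuple_powerD T a (x y : H) : tuple_power (fun j => T j) a (x + y) =
  tuple_power (fun j => T j) a x + tuple_power (fun j => T j) a y.
Proof.
rewrite /tuple_power; elim: (index_enum 'I_d) => [|j s IHs].
  by rewrite !big_nil.
rewrite !big_cons /= IHs.
by elim: (a j) => //= n ->; rewrite linearD.
Qed.

Lemma tuple_power_stable (T : 'I_d -> H -> H) a (M : set H) :
  (forall j, T j @` M `<=` M) -> tuple_power T a @` M `<=` M.
Proof.
move=> TM _ [x Mx <-]; rewrite /tuple_power.
elim: (index_enum 'I_d) => [|j s IHs]; first by rewrite big_nil.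
rewrite big_cons /=; elim: (a j) => //= n IHn.
by apply: (TM j); exists (iter n (T j)
  ((\big[@comp H H H/idfun]_(k <- s) iter (a k) (T k)) x)).
Qed.

(** The kernel part of [x] is killed by [T^a], and [T^a] keeps the orthogonal
    part orthogonal to the kernel. *)
Lemma tuple_power_orthogonal T a :
    closed_subspace (null_space (tuple_power (fun j => T j) a)) ->
    (forall j, reducing_subspace (T j)
                 (null_space (tuple_power (fun j => T j) a))) ->
  forall u x, null_space (tuple_power (fun j => T j) a) u ->
    '[u, tuple_power (fun j => T j) a x] = 0.
Proof.
set N := null_space _ => cN redN u x Nu.
have [y Ny xy] := orthogonal_decomposition cN x.
have Ty0 : tuple_power (fun j => T j) a y = 0 by exact: Ny.
rewrite -(subrK y x) tuple_powerD Ty0 addr0.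
suff : orthogonal_complement N (tuple_power (fun j => T j) a (x - y)) by apply.
apply: (@tuple_power_stable (fun j => T j)); last by exists (x - y).
by move=> j; have [] := redN j.
Qed.

End TuplePowers.

(** * Approximate eigenvectors *)

Section ApproximateEigenvalues.
Variables (R : realType) (H : hilbertType R) (d : nat).
Variables (T : 'I_d -> {linear H -> H}) (l : 'rV[R[i]]_d) (x : nat -> H).
Hypothesis T_bounded : forall j, bounded_operator (T j).
Hypothesis x_unit : forall n, `|x n| = 1.
Hypothesis x_eigen : forall j,
  T j (x n) - l 0 j *: x n @[n --> \oo] --> (0 : H).

(** Composing with an arbitrary [f] on the right lets the statement be used for
    [T^a] and, with [f := T^q], for [T^a T^q]. *)
Lemma approximate_eigenvalue_tuple_power (a : 'I_d -> nat) (f : H -> H)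
    (c : R[i]) :
    f (x n) - c *: x n @[n --> \oo] --> (0 : H) ->
  tuple_power (fun j => T j) a (f (x n)) - ((\prod_j l 0 j ^+ a j) * c) *: x n
    @[n --> \oo] --> (0 : H).
Proof.
have step j (g : H -> H) (b : R[i]) :
    g (x n) - b *: x n @[n --> \oo] --> (0 : H) ->
    T j (g (x n)) - (l 0 j * b) *: x n @[n --> \oo] --> (0 : H).
  move=> gb.
  (* The new error is the image of the old one, plus b times that of T j. *)
  have -> : (fun n => T j (g (x n)) - (l 0 j * b) *: x n) =
      (fun n => T j (g (x n) - b *: x n) + b *: (T j (x n) - l 0 j *: x n)).
    apply/funext => n.
    rewrite (linearB (T j)) (linearZ_LR (T j)) scalerBr scalerA [b * _]mulrC.
    by rewrite addrA subrK.
  rewrite -[0 : H]addr0; apply: cvgD; last first.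
    by rewrite -[0 : H](scaler0 _ b); apply: cvgZl_tmp; exact: x_eigen.
  have Tc : T j y @[y --> (0 : H)] --> T j 0.
    exact: (bounded_linear_continuous (T_bounded j)).
  by rewrite linear0 in Tc; exact: (cvg_comp _ _ gb Tc).
move=> fc; rewrite /tuple_power.
elim: (index_enum 'I_d) => [|j s IHs].
  by rewrite !big_nil mul1r.
rewrite !big_cons -mulrA /=; elim: (a j) => [|n IHn] /=.
  by rewrite expr0 mul1r.
rewrite exprS -mulrA.
exact: (step j (fun v => iter n (T j)
  ((\big[@comp H H H/idfun]_(k <- s) iter (a k) (T k)) (f v)))).
Qed.

Lemma cvg_inner_approximate_eigen (u v : nat -> H) (a b : R[i]) :
    u n - a *: x n @[n --> \oo] --> (0 : H) ->
    v n - b *: x n @[n --> \oo] --> (0 : H) ->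
  ('[u n, v n] : R[i]^o) @[n --> \oo] --> (a * b^* : R[i]^o).
Proof.
move=> ua vb; apply/cvgrPdist_le => e e0.
(* The error is at most r * (1 + |b|) + |a| * r, where 1 + |b| bounds the
   norm of v n. *)
pose r := e / 2 / (1 + `|a| + `|b|).
have ab1 : 0 < 1 + `|a| + `|b| by rewrite -addrA ltr_wpDr ?addr_ge0.
have r0 : 0 < r by rewrite !divr_gt0.
near=> n.
have un : `|u n - a *: x n| <= r.
  by near: n; move: ua => /cvgr0Pnorm_le /(_ _ r0); exact.
have vn1 : `|v n - b *: x n| <= 1.
  by near: n; move: vb => /cvgr0Pnorm_le /(_ _ ltr01); exact.
have vn : `|v n - b *: x n| <= r.
  by near: n; move: vb => /cvgr0Pnorm_le /(_ _ r0); exact.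
have vb1 : `|v n| <= 1 + `|b|.
  rewrite -[v n](subrK (b *: x n)) (le_trans (ler_normD _ _)) //.
  by rewrite lerD // normrZ x_unit mulr1.
have -> : a * b^* - '[u n, v n] =
   - ('[u n - a *: x n, v n] + a * '[x n, v n - b *: x n]).
  rewrite -[- (a *: _)]scaleN1r -[- (b *: _)]scaleN1r.
  rewrite !(innerDl, innerDr, innerZl, innerZr) innerE x_unit.
  by rewrite rmorphN rmorph1; ring.
rewrite normrN (le_trans (ler_normD _ _)) //.
have -> : e = r * (1 + `|a| + `|b|) + r * (1 + `|a| + `|b|).
  by rewrite /r divfK ?gt_eqF // -splitr.
apply: lerD.
  rewrite (le_trans (cauchy_schwarz _ _)) // ler_pM //.
  by rewrite (le_trans vb1) // addrAC lerDl.
rewrite normrM mulrC ler_pM //.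
  by rewrite (le_trans (cauchy_schwarz _ _)) // x_unit mul1r.
by rewrite addrAC lerDr addr_ge0.
Unshelve. all: by end_near. Qed.

End ApproximateEigenvalues.

(** * The isometry defect at an approximate eigenvector *)

Lemma cvg_finite_sum (K : numFieldType) (V : normedModType K) (I : Type)
    (s : seq I) (P : pred I) (f : I -> nat -> V) (c : I -> V) :
    (forall i, P i -> f i n @[n --> \oo] --> c i) ->
  \sum_(i <- s | P i) f i n @[n --> \oo] --> \sum_(i <- s | P i) c i.
Proof.
move=> fc; elim: s => [|i s IHs].
  by under eq_cvg do rewrite big_nil; rewrite big_nil; exact: cvg_cst.
under eq_cvg do rewrite big_cons; rewrite big_cons.
by case: ifP => [/fc fi|_] //; exact: (cvgD fi IHs).
Qed.

Lemma limit_of_zeros (K : numFieldType) (V : normedModType K) (u : nat -> V)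
    (c : V) :
  (forall n, u n = 0) -> u n @[n --> \oo] --> c -> c = 0.
Proof.
move=> u0; under eq_cvg do rewrite u0; move=> c0.
exact: (cvg_unique _ c0 (cvg_cst 0)).
Qed.

Section IsometryDefect.
Variables (R : realType) (H : hilbertType R) (d : nat).
Implicit Types (T : 'I_d -> {linear H -> H}) (l : 'rV[R[i]]_d).

Lemma inner_suml (I : Type) (s : seq I) (P : pred I) (f : I -> H) (y : H) :
  '[\sum_(i <- s | P i) f i, y] = \sum_(i <- s | P i) '[f i, y].
Proof.
apply: (big_morph (fun x => '[x, y])) => [u v|]; first exact: innerDl.
by rewrite -(scale0r 0) innerZl mul0r.
Qed.

Lemma inner_isometry_defect m T (x y : H) :
    (forall j, bounded_operator (T j)) -> commuting (fun j => T j) ->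
  '[isometry_defect m (fun j => T j) x, y] =
  \sum_(k < m.+1) ((-1) ^+ k *+ 'C(m, k)) *
    \sum_(a : {ffun 'I_d -> 'I_k.+1} | (\sum_j a j)%N == k)
      (k`!%:R / (\prod_j (a j)`!)%N%:R) *
        '[tuple_power (fun j => T j) (fun j => a j) x,
          tuple_power (fun j => T j) (fun j => a j) y].
Proof.
move=> bT cT; rewrite inner_suml; apply: eq_bigr => k _.
rewrite innerZl inner_suml; congr (_ * _); apply: eq_bigr => a _.
by rewrite innerZl adjoint_tuple_power.
Qed.

(** The scalar counterpart of the defect, with [l] in place of the tuple: the
    multinomial theorem sums the inner sum to the [k]-th power of the squared
    norm of [l], and the binomial theorem does the rest. *)
Lemma scalar_isometry_defect m l :
  \sum_(k < m.+1) ((-1) ^+ k *+ 'C(m, k)) *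
    \sum_(a : {ffun 'I_d -> 'I_k.+1} | (\sum_j a j)%N == k)
      (k`!%:R / (\prod_j (a j)`!)%N%:R) *
        ((\prod_j l 0 j ^+ a j) * (\prod_j l 0 j ^+ a j)^*) =
  (1 - \sum_j `|l 0 j| ^+ 2) ^+ m.
Proof.
rewrite exprBn; apply: eq_bigr => k _.
rewrite expr1n mulr1 mulrnAl -multinomial_sum; congr (_ * _ *+ _).
apply: eq_bigr => a _; congr (_ * _).
rewrite rmorph_prod -big_split; apply: eq_bigr => j _ /=.
by rewrite -normCK normrX -!exprM mulnC.
Qed.

(** In the limit the term of index [a] becomes [`|l ^ a| ^+ 2 * (l ^ q)^*].  The
    second factor is the same for all terms, and what remains is the scalar
    defect. *)
Lemma cvg_inner_isometry_defect m T l (x : nat -> H) (q : 'I_d -> nat) :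
    (forall j, bounded_operator (T j)) -> commuting (fun j => T j) ->
    (forall n, `|x n| = 1) ->
    (forall j, T j (x n) - l 0 j *: x n @[n --> \oo] --> (0 : H)) ->
  ('[isometry_defect m (fun j => T j) (x n),
     tuple_power (fun j => T j) q (x n)] : R[i]^o) @[n --> \oo] -->
  ((1 - \sum_j `|l 0 j| ^+ 2) ^+ m * (\prod_j l 0 j ^+ q j)^* : R[i]^o).
Proof.
move=> bT cT x1 xl.
under eq_cvg do rewrite inner_isometry_defect //.
rewrite -scalar_isometry_defect mulr_suml.
apply: (@cvg_finite_sum R[i] R[i]^o) => k _; rewrite -mulrA.
apply: (@cvgMl_tmp R[i]); rewrite mulr_suml.
apply: (@cvg_finite_sum R[i] R[i]^o) => a _.
rewrite -[_ * _ * (\prod_j l 0 j ^+ q j)^*]mulrA; apply: (@cvgMl_tmp R[i]).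
rewrite -mulrA -rmorphM.
have x0 : x n - 1 *: x n @[n --> \oo] --> (0 : H).
  by under eq_cvg do rewrite scale1r subrr; exact: cvg_cst.
have xq : tuple_power (fun j => T j) q (x n) - (\prod_j l 0 j ^+ q j) *: x n
    @[n --> \oo] --> (0 : H).
  rewrite -[\prod_j _]mulr1.
  exact: (approximate_eigenvalue_tuple_power bT xl _ (f := idfun) x0).
apply: (cvg_inner_approximate_eigen x1).
  rewrite -[\prod_j _]mulr1.
  exact: (approximate_eigenvalue_tuple_power bT xl _ (f := idfun) x0).
exact: (approximate_eigenvalue_tuple_power bT xl _ xq).
Qed.

End IsometryDefect.

Theorem theorem3p1 (R : realType) (H : hilbertType R)
    (H_infinite : ~ finite_dimensional H) (H_separable : separable H)
    (d m : nat) (d_gt0 : (0 < d)%N) (m_gt0 : (0 < m)%N) (q : 'I_d -> nat)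
    (T : 'I_d -> {linear H -> H}) (T_bounded : forall j, bounded_operator (T j))
    (T_isom : joint_partial_isometry m q (fun j => T j))
    (T_reducing : forall j,
       reducing_subspace (T j) (null_space (tuple_power (fun j => T j) q))) :
  approximate_point_spectrum (fun j => T j) `<=`
    @unit_sphere R d `|` @zero_product R d.
Proof.
move=> l [x [x_unit x_eigen]].
have [T_comm T_defect] := T_isom.
have N_closed : closed_subspace (null_space (tuple_power (fun j => T j) q)).
  by have [] := T_reducing (Ordinal d_gt0).
have [l0|l0] := eqVneq (\prod_j l 0 j) 0; first by right.
left; rewrite /unit_sphere /= /norm2.
suff -> : \sum_j `|l 0 j| ^+ 2 = 1 by rewrite sqrtC1.
(* The sequence in lim0 is identically zero: T_defect puts its left arguments
   in the kernel of T^q, and its right arguments are orthogonal to it. *)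
have lim0 := cvg_inner_isometry_defect (m := m) (q := q)
  T_bounded T_comm x_unit x_eigen.
have : (1 - \sum_j `|l 0 j| ^+ 2) ^+ m * (\prod_j l 0 j ^+ q j)^* = 0.
  apply: (limit_of_zeros _ lim0) => n.
  by rewrite (tuple_power_orthogonal N_closed T_reducing).
move/eqP; rewrite mulf_eq0 conjC_eq0 => /orP[|/prodf_eq0 [j _]].
  by rewrite expf_eq0 m_gt0 subr_eq0 => /eqP.
by rewrite expf_eq0 => /andP[_]; move/prodf_neq0: l0 => /(_ j isT) /negbTE ->.
Qed.
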